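(* Let $p,q>1$ with $1/p+1/q=1$, and let $0<a\le A<\infty$ and $0<b\le B<\infty$ be real numbers. Let $n$ be a positive integer or $\infty$, let $\{a_k\}_{k=1}^n$ and $\{b_k\}_{k=1}^n$ be non-increasing real sequences with $$a\le a_k\le A,\qquad b\le b_k\le B,\qquad k=1,\ldots,n,$$ and let $\{p_k\}_{k=1}^n$ be real weights such that $P_k:=\sum_{m=1}^k p_m\ge 0$ for $k=1,\ldots,n$. Assume $\sum_{k=1}^n p_ka_kb_k\neq 0$ (and, if $n=\infty$, that the series below converge). Then $$0\le \frac{\left(\sum_{k=1}^n p_k a_k^q\right)^{1/q}\left(\sum_{k=1}^n p_k b_k^p\right)^{1/p}}{\sum_{k=1}^n p_k a_k b_k}\le \left(\frac{pA}{a}\right)^{1/p}\left(\frac{qB}{b}\right)^{1/q}.$$ Moreover, there is no positive constant depending on $a,A,b,B,p,q$ that bounds the fraction from below; that is, there is no function $c$ assigning to each admissible tuple $(a,A,b,B,p,q)$ (meaning real numbers with $0<a\le A<\infty$, $0<b\le B<\infty$, $p,q>1$ and $1/p+1/q=1$) a number $c(a,A,b,B,p,q)>0$ such that the fraction is at least $c(a,A,b,B,p,q)$ for all admissible tuples, all $n$ (a positive integer or $\infty$), all non-increasing real sequences $\{a_k\}_{k=1}^n$ and $\{b_k\}_{k=1}^n$ with $a\le a_k\le A$ and $b\le b_k\le B$ for $k=1,\ldots,n$, and all real weights $\{p_k\}_{k=1}^n$ with $\sum_{m=1}^k p_m\ge 0$ for $k=1,\ldots,n$ and $\sum_{k=1}^n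 p_ka_kb_k\neq 0$ (and, if $n=\infty$, such that the series in the fraction converge).
   Context: The weights $p_k$ are real numbers and may be negative; the indexed weights $p_k$ are unrelated to the exponent $p$. *)

(* Defs.v *)
From HB Require Import structures.
From mathcomp Require Export all_boot all_order all_algebra.
From mathcomp Require Export all_classical all_reals all_analysis.
Export Order.TTheory GRing.Theory Num.Theory.
Export numFieldNormedType.Exports.

Set Implicit Arguments.
Unset Strict Implicit.
Unset Printing Implicit Defensive.

Local Open Scope ring_scope.
Local Open Scope classical_set_scope.

(* A length n is an [option nat]: [Some m] is the integer m, [None] is infinity.
   A sequence (u_k), k = 1..n, is a total function [nat -> R]; its values at 0
   and beyond n are never used. *)

Definition range1 (n : option nat) : pred nat :=
  fun k => (0 < k)%N && (if n is Some m then (k <= m)%N else true).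

Definition psum (R : realType) (u : nat -> R) (k : nat) : R :=
  \sum_(1 <= m < k.+1) u m.

(* For n = None convergence is that of the partial sums, not necessarily
   absolute; [sum1 None u] is meaningful only under [summable1 None u]. *)
Definition summable1 (R : realType) (n : option nat) (u : nat -> R) : Prop :=
  if n is None then cvgn (psum u) else True.

Definition sum1 (R : realType) (n : option nat) (u : nat -> R) : R :=
  if n is Some m then psum u m else limn (psum u).

Definition nonincreasing1 (R : realType) (n : option nat) (u : nat -> R) :=
  forall j k, range1 n j -> range1 n k -> (j <= k)%N -> u k <= u j.

Record admissible_params (R : realType) (a A b B p q : R) : Prop := {
  a_gt0 : 0 < a;
  a_le_A : a <= A;
  b_gt0 : 0 < b;
  b_le_B : b <= B;
  p_gt1 : 1 < p;
  q_gt1 : 1 < q;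
  conjugate_pq : 1 / p + 1 / q = 1
}.

(* [x], [y] are the sequences (a_k), (b_k), and [w] the weights (p_k). *)
Record admissible_data (R : realType) (a A b B p q : R)
    (n : option nat) (x y w : nat -> R) : Prop := {
  length_gt0 : n <> Some 0%N;
  x_nonincreasing : nonincreasing1 n x;
  y_nonincreasing : nonincreasing1 n y;
  x_bounds : forall k, range1 n k -> a <= x k <= A;
  y_bounds : forall k, range1 n k -> b <= y k <= B;
  psum_w_ge0 : forall k, range1 n k -> 0 <= psum w k;
  summable_xq : summable1 n (fun k => w k * x k `^ q);
  summable_yp : summable1 n (fun k => w k * y k `^ p);
  summable_xy : summable1 n (fun k => w k * x k * y k);
  sum_xy_neq0 : sum1 n (fun k => w k * x k * y k) <> 0
}.

(* Both sums raised to a power are nonnegative on admissible data, and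
   [0 `^ r = 0] for r <> 0, so the roots are the usual ones. *)
Definition holder_ratio (R : realType) (p q : R)
    (n : option nat) (x y w : nat -> R) : R :=
  (sum1 n (fun k => w k * x k `^ q)) `^ (1 / q) *
  (sum1 n (fun k => w k * y k `^ p)) `^ (1 / p) /
  sum1 n (fun k => w k * x k * y k).

(* Main.v *)
(* Abel summation shows that [sum w_k g_k >= 0] for every nonnegative
   non-increasing [g].  With [K = q A^(q-1) / b], Young's inequality gives
   [u^q - v^q <= q u^(q-1) (u - v)], so [g_k = K x_k y_k - x_k^q] is
   nonnegative and non-increasing; hence [sum w x^q <= K sum w x y].
   Symmetrically [sum w y^p <= (p B^(p-1) / a) sum w x y], and the upper bound
   is the product of the roots of these two constants.  For the lower bound,
   a constant [x] and the weights 1, -1 make the first sum vanish. *)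
Require Import Defs.
From mathcomp Require Import ring lra.

Set Implicit Arguments.
Unset Strict Implicit.
Unset Printing Implicit Defensive.

Local Open Scope ring_scope.
Local Open Scope classical_set_scope.

(** Abel summation as an induction: passing from [k] to [k.+1], the accumulated [psum w k >= 0] is
    re-weighted from [g k] down to the smaller [g k.+1]. *)
Lemma abel_psum_ge (R : realType) (n : option nat) (w g : nat -> R) (k : nat) :
  (forall j, range1 n j -> 0 <= psum w j) -> nonincreasing1 n g ->
  range1 n k -> psum w k * g k <= psum (fun j => w j * g j) k.
Proof.
move=> w0 gdec; elim: k => [//|k IH] nk; rewrite /psum 2?(@big_nat_recr _ _ _ k.+1)//=.
(* The induction really starts at index 1, since 0 lies outside [range1]. *)
have [->|k0] := posnP k; first by rewrite !big_geq// !add0r.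
have nk' : range1 n k.
  by move: nk; rewrite /range1 k0 /=; case: (n) => // m /ltnW.
rewrite mulrDl lerD2r; apply: le_trans (IH nk').
by rewrite ler_wpM2l ?w0// gdec.
Qed.

Lemma sum1_ge0 (R : realType) (n : option nat) (u : nat -> R) :
  n <> Some 0%N -> summable1 n u -> (forall k, range1 n k -> 0 <= psum u k) ->
  0 <= sum1 n u.
Proof.
case: n => [m|] /= n0 cu u0.
  by apply: u0; rewrite /range1 leqnn andbT; case: m n0.
apply: limr_ge => //; near=> k; apply: u0; rewrite /range1 andbT.
by near: k; exact: nbhs_infty_gt.
Unshelve. all: by end_near. Qed.

Lemma abel_sum1_ge0 (R : realType) (n : option nat) (w g : nat -> R) :
  n <> Some 0%N -> (forall k, range1 n k -> 0 <= psum w k) ->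
  nonincreasing1 n g -> (forall k, range1 n k -> 0 <= g k) ->
  summable1 n (fun k => w k * g k) -> 0 <= sum1 n (fun k => w k * g k).
Proof.
move=> n0 w0 gdec g0 cg; apply: sum1_ge0 => // k nk.
by apply: (le_trans _ (abel_psum_ge w0 gdec nk)); rewrite mulr_ge0 ?w0 ?g0.
Qed.

(** The combination [c * u - v] is the shape of the Abel summand [K w x y - w x^q]. Convergence may
    be merely conditional, so linearity is taken from the partial sums. *)
Lemma psumB_scale (R : realType) (c : R) (u v : nat -> R) :
  psum (fun k => c * u k - v k) = (fun k => c * psum u k - psum v k).
Proof. by apply/funext => k; rewrite /psum sumrB mulr_sumr. Qed.

Lemma summable1B_scale (R : realType) (n : option nat) (c : R) (u v : nat -> R) :
  summable1 n u -> summable1 n v -> summable1 n (fun k => c * u k - v k).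
Proof.
case: n => //= cu cv; rewrite psumB_scale.
by apply: is_cvgB => //; exact: is_cvgMr.
Qed.

Lemma sum1B_scale (R : realType) (n : option nat) (c : R) (u v : nat -> R) :
  summable1 n u -> summable1 n v ->
  sum1 n (fun k => c * u k - v k) = c * sum1 n u - sum1 n v.
Proof.
case: n => [m|] /= cu cv; rewrite psumB_scale//.
by apply/cvg_lim => //; apply: cvgB => //; exact: cvgMr.
Qed.

(** The graph of [t^q] lies above its tangent at [u]. This is Young's inequality for [u^(q-1)] and
    [v], multiplied by [q], with [(q-1) p = q] and [q/p = q-1]. *)
Lemma powRB_le (R : realType) (p q u v : R) :
  0 < p -> 0 < q -> 1 / p + 1 / q = 1 -> 0 <= u -> 0 <= v ->
  u `^ q - v `^ q <= q * u `^ (q - 1) * (u - v).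
Proof.
move=> p0 q0 pq u0 v0.
have qne : q != 0 by rewrite gt_eqF.
have pq' : p^-1 + q^-1 = 1 by rewrite -pq !div1r.
have qp : q / p = q - 1 by rewrite (_ : p^-1 = 1 - q^-1); [field | lra].
have qp' : (q - 1) * p = q by rewrite -qp divfK ?gt_eqF.
have young := conjugate_powR (powR_ge0 u (q - 1)) v0 p0 q0 pq'.
rewrite -powRrM qp' in young.
have uq : u `^ (q - 1) * u = u `^ q by rewrite mulrC mulr_powRB1.
have young' : q * (u `^ (q - 1) * v) <= (q - 1) * u `^ q + v `^ q.
  apply: le_trans (ler_wpM2l (ltW q0) young) _.
  by rewrite mulrDr mulrCA qp [_ * (q - 1)]mulrC [q * (_ / q)]mulrCA divff// mulr1.
by rewrite mulrBr -!mulrA uq; lra.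
Qed.

(** Only an upper bound on [x] and a lower bound on [y] enter, so the same statement serves again
    with [x], [y] and [p], [q] exchanged. *)
Lemma sum1_powR_le (R : realType) (A b p q : R) (n : option nat)
    (x y w : nat -> R) :
  0 < b -> 0 < p -> 1 < q -> 1 / p + 1 / q = 1 ->
  n <> Some 0%N -> nonincreasing1 n x -> nonincreasing1 n y ->
  (forall k, range1 n k -> 0 <= x k <= A) ->
  (forall k, range1 n k -> b <= y k) ->
  (forall k, range1 n k -> 0 <= psum w k) ->
  summable1 n (fun k => w k * x k `^ q) ->
  summable1 n (fun k => w k * x k * y k) ->
  sum1 n (fun k => w k * x k `^ q)
    <= q * A `^ (q - 1) / b * sum1 n (fun k => w k * x k * y k).
Proof.
move=> b0 p0 q1 pq n0 xdec ydec xA yb w0 cx cxy.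
have q0 : 0 < q by lra.
set K := q * A `^ (q - 1) / b.
have Kb : K * b = q * A `^ (q - 1) by rewrite /K divfK// gt_eqF.
have K0 : 0 <= K by rewrite /K !mulr_ge0 ?powR_ge0 ?invr_ge0 ?ltW.
(* [K b = q A^(q-1)] is the largest slope of [t^q] on [[0, A]]. *)
have slope u v : 0 <= v -> v <= u -> u <= A ->
    u `^ q - v `^ q <= K * b * (u - v).
  move=> v0 vu uA; have u0 := le_trans v0 vu.
  apply: le_trans (powRB_le p0 q0 pq u0 v0) _.
  rewrite Kb ler_wpM2r ?subr_ge0// ler_wpM2l ?(ltW q0)//.
  by rewrite ge0_ler_powR ?subr_ge0 ?(ltW q1) ?nnegrE// (le_trans u0).
have gE : (fun k => K * (w k * x k * y k) - w k * x k `^ q) =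
          (fun k => w k * (K * (x k * y k) - x k `^ q)).
  by apply/funext => k; ring.
rewrite -subr_ge0 -sum1B_scale// gE; apply: abel_sum1_ge0 => //.
- move=> j k nj nk jk.
  have /andP[xk0 xkA] := xA _ nk; have /andP[xj0 xjA] := xA _ nj.
  have xkj := xdec _ _ nj nk jk; have ykj := ydec _ _ nj nk jk.
  have := slope _ _ xk0 xkj xjA; have ykb := yb _ nk.
  (* Here [x_j y_j - x_k y_k = (x_j - x_k) y_k + x_j (y_j - y_k)], where [y_k >= b] and the last
     product is nonnegative. *)
  suff : K * b * (x j - x k) <= K * (x j * y j - x k * y k) by lra.
  by rewrite -mulrA ler_wpM2l//; nra.
- move=> k nk; have /andP[xk0 xkA] := xA _ nk; have ykb := yb _ nk.
  (* The slope bound from 0 gives [x_k^q <= K b x_k <= K x_k y_k]. *)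
  have := slope _ _ (lexx 0) xk0 xkA.
  rewrite powR0 ?gt_eqF// !subr0 => /le_trans h; rewrite subr_ge0; apply: h.
  by rewrite -mulrA ler_wpM2l// mulrC ler_wpM2l.
- by rewrite -gE; exact: summable1B_scale.
Qed.

Lemma nonincreasing1_powR (R : realType) (n : option nat) (r : R)
    (x : nat -> R) :
  0 <= r -> (forall k, range1 n k -> 0 <= x k) -> nonincreasing1 n x ->
  nonincreasing1 n (fun k => x k `^ r).
Proof.
move=> r0 x0 xdec j k nj nk jk.
by rewrite ge0_ler_powR ?nnegrE ?x0// xdec.
Qed.

Lemma holder_ratio_bounds (R : realType) (a A b B p q : R) (n : option nat)
    (x y w : nat -> R) :
  admissible_params a A b B p q ->
  admissible_data a A b B p q n x y w ->
  0 <= holder_ratio p q n x y w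
    <= (p * A / a) `^ (1 / p) * (q * B / b) `^ (1 / q).
Proof.
move=> [a0 aA b0 bB p1 q1 pq] [n0 xdec ydec xA yB w0 cx cy cxy S0].
have [p0 q0] : 0 < p /\ 0 < q by lra.
have x0 k : range1 n k -> 0 <= x k by move=> /xA; lra.
have y0 k : range1 n k -> 0 <= y k by move=> /yB; lra.
have [A0 B0] : 0 < A /\ 0 < B by lra.
have yxE : (fun k => w k * y k * x k) = (fun k => w k * x k * y k).
  by apply/funext => k; rewrite mulrAC.
have X0 : 0 <= sum1 n (fun k => w k * x k `^ q).
  apply: abel_sum1_ge0 => // [|k _]; last exact: powR_ge0.
  by apply: nonincreasing1_powR => //; exact: ltW.
have Y0 : 0 <= sum1 n (fun k => w k * y k `^ p).
  apply: abel_sum1_ge0 => // [|k _]; last exact: powR_ge0.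
  by apply: nonincreasing1_powR => //; exact: ltW.
have X_le : sum1 n (fun k => w k * x k `^ q)
    <= q * A `^ (q - 1) / b * sum1 n (fun k => w k * x k * y k).
  apply: (@sum1_powR_le _ A b p) => // k nk.
    by rewrite x0//=; have := xA _ nk; lra.
  by have := yB _ nk; lra.
have Y_le : sum1 n (fun k => w k * y k `^ p)
    <= p * B `^ (p - 1) / a * sum1 n (fun k => w k * x k * y k).
  rewrite -yxE; apply: (@sum1_powR_le _ B a q) => //.
  - by rewrite addrC.
  - by move=> k nk; rewrite y0//=; have := yB _ nk; lra.
  - by move=> k nk; have := xA _ nk; lra.
  - by rewrite yxE.
(* Abel summation with [g = x y] gives [S >= 0], and [S] is nonzero by assumption. *)
have {S0} S_gt0 : 0 < sum1 n (fun k => w k * x k * y k).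
  rewrite lt0r; apply/andP; split; first exact/eqP.
  have wxyE : (fun k => w k * x k * y k) = (fun k => w k * (x k * y k)).
    by apply/funext => k; rewrite mulrA.
  rewrite wxyE; apply: abel_sum1_ge0 => //; last by rewrite -wxyE.
  - by move=> j k nj nk jk; rewrite ler_pM ?x0 ?y0 ?xdec ?ydec.
  - by move=> k nk; rewrite mulr_ge0 ?x0 ?y0.
rewrite /holder_ratio; move: X0 Y0 X_le Y_le S_gt0.
set X := sum1 n _; set Y := sum1 n _; set S := sum1 n _ => X0 Y0 XS YS S_gt0.
rewrite divr_ge0 ?mulr_ge0 ?powR_ge0 ?(ltW S_gt0)//= ler_pdivrMr//.
have rp0 : 0 <= 1 / p by rewrite divr_ge0 ?ltW.
have rq0 : 0 <= 1 / q by rewrite divr_ge0 ?ltW.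
have S_split : S = S `^ (1 / q) * S `^ (1 / p).
  by rewrite -powRD addrC pq ?powRr1 ?ltW// oner_eq0.
(* The [1/q]-th root of [A^(q-1)] is thus [A^(1/p)], and likewise [B^(p-1)] yields [B^(1/q)]; this
   is how [A] joins [p/a] and [B] joins [q/b] in the final bound. *)
have expq : (q - 1) * (1 / q) = 1 / p.
  have -> : 1 / p = 1 - 1 / q by lra.
  by field; rewrite gt_eqF.
have expp : (p - 1) * (1 / p) = 1 / q.
  have -> : 1 / q = 1 - 1 / p by lra.
  by field; rewrite gt_eqF.
have rX : X `^ (1 / q) <= (q * A `^ (q - 1) / b * S) `^ (1 / q).
  by rewrite ge0_ler_powR// nnegrE// (le_trans X0).
have rY : Y `^ (1 / p) <= (p * B `^ (p - 1) / a * S) `^ (1 / p).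
  by rewrite ge0_ler_powR// nnegrE// (le_trans Y0).
apply: le_trans (ler_pM (powR_ge0 _ _) (powR_ge0 _ _) rX rY) _.
have nneg := (ltW p0, ltW q0, ltW a0, ltW b0, ltW A0, ltW B0, ltW S_gt0).
rewrite [in leRHS]S_split !powRM ?mulr_ge0 ?powR_ge0 ?invr_ge0 ?nneg//.
by rewrite -!powRrM expq expp le_eqVlt; apply/orP; left; apply/eqP; ring.
Qed.

Lemma holder_ratio_eq0 (R : realType) :
  exists (a A b B p q : R) (n : option nat) (x y w : nat -> R),
  [/\ admissible_params a A b B p q,
      admissible_data a A b B p q n x y w & holder_ratio p q n x y w = 0].
Proof.
(* The drop of [y] from 2 to 1 keeps the denominator at [2 - 1 = 1] while the sum of [w x^q] is
   [1 - 1 = 0]. *)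
pose y (k : nat) : R := if k == 1%N then 2 else 1.
pose w (k : nat) : R := if k == 1%N then 1 else -1.
have psum1 (u : nat -> R) : psum u 1 = u 1%N by rewrite /psum big_nat1.
have psum2 (u : nat -> R) : psum u 2 = u 1%N + u 2%N.
  by rewrite /psum big_nat_recr//= big_nat1.
exists 1, 1, 1, 2, 2, 2, (Some 2%N), (fun=> 1), y, w; split.
- by split; lra.
- split => //.
  + move=> j k; rewrite /range1/y.
    by case: j => [|[|[|j]]] //; case: k => [|[|[|k]]] //= _ _ _; lra.
  + by move=> k _; lra.
  + by move=> k _; rewrite /y; case: ifP => _; lra.
  + move=> k; rewrite /range1; case: k => [|[|[|k]]] //= _.
      by rewrite psum1.
    by rewrite psum2 /w/=; lra.
  + by rewrite /= psum2 /w/y/=; lra.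
- by rewrite /holder_ratio /= psum2 /w/= powR1 !mulr1 subrr powR0 ?mul0r//.
Qed.

Theorem theorem1 (R : realType) :
  (forall (a A b B p q : R) (n : option nat) (x y w : nat -> R),
     admissible_params a A b B p q ->
     admissible_data a A b B p q n x y w ->
     0 <= holder_ratio p q n x y w
       <= (p * A / a) `^ (1 / p) * (q * B / b) `^ (1 / q))
  /\
  ~ (exists c : R -> R -> R -> R -> R -> R -> R,
       (forall a A b B p q : R,
          admissible_params a A b B p q -> 0 < c a A b B p q) /\
       (forall (a A b B p q : R) (n : option nat) (x y w : nat -> R),
          admissible_params a A b B p q ->
          admissible_data a A b B p q n x y w ->
          c a A b B p q <= holder_ratio p q n x y w)).
Proof.
split; first exact: holder_ratio_bounds.
move=> [c [c0 c_le]].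
have [a [A [b [B [p [q [n [x [y [w [par dat ratio0]]]]]]]]]]] := holder_ratio_eq0 R.
have := c_le _ _ _ _ _ _ _ _ _ _ par dat.
by rewrite ratio0 leNgt c0.
Qed.
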